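(* Let $f\in\mathcal{F}_{\mu,L}$ with minimizer $x^*$. Let $0<a\le\frac14$, $s>0$, and set $m=(1-a)\sqrt{s}$, $n=q=\sqrt{a\mu}$, $p=\frac{a}{q}+\sqrt{s}$, where $q\sqrt{s}\le\frac12$ and $s\le\frac{4}{3L}$. Then the iteration, for $k\ge 0$, $$x_{k+1}-x_k=-m\sqrt{s}\,\nabla f(x_k)-n\sqrt{s}\,(x_{k+1}-v_k),$$ $$v_{k+1}-v_k=-p\sqrt{s}\,\nabla f(x_{k+1})-q\sqrt{s}\,(v_k-x_{k+1}),$$ reduces to the quasi-hyperbolic momentum method $$x_{k+1}-x_k=-s(1-a)\nabla f(x_k)-s a\,g_{k+1},\qquad g_{k+1}=b\,g_k+\nabla f(x_k),$$ with $b=\frac{1-q\sqrt{s}}{1+q\sqrt{s}}$. Furthermore, when initialized at an arbitrary $x_0\in\mathbb{R}^d$ and $v_0=x_0-\frac{m}{n}\nabla f(x_0)$, the iterates satisfy $$f(x_k)-f(x^* )\le C_{QHM}(1-\sqrt{a\mu s})^k\quad\text{for all }k\ge 0,$$ where $C_{QHM}$ is a positive constant.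
   Context: $\mathcal{F}_{\mu,L}$ ($0<\mu\le L$) is the class of functions $f:\mathbb{R}^d\to\mathbb{R}$ that are $\mu$-strongly convex and $L$-smooth (the gradient is $L$-Lipschitz). ''Reduces to'' means that, after eliminating $v_k$ from the first iteration and $g_k$ from the second, both give the same recursion for $x_{k+1}$ in terms of $x_k,x_{k-1}$. The constant $C_{QHM}$ does not depend on $k$ (it may depend on $f$, the starting point and the parameters). *)

(* Defs.v *)
From HB Require Import structures.
From mathcomp Require Import all_boot all_order all_algebra.
From mathcomp Require Import all_classical all_reals all_analysis.

Set Implicit Arguments.
Unset Strict Implicit.
Unset Printing Implicit Defensive.

Import Order.TTheory GRing.Theory Num.Theory.
Import numFieldNormedType.Exports.

Local Open Scope ring_scope.

(* The canonical norm `|x| on 'rV[R]_d is the sup norm, hence this separate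
   Euclidean norm. Differentiability does not depend on this choice. *)
Definition enorm (R : realType) (d : nat) (x : 'rV[R]_d) : R :=
  Num.sqrt (\sum_(i < d) x ord0 i ^+ 2).

Definition grad (R : realType) (d : nat) (f : 'rV[R]_d -> R) (x : 'rV[R]_d) :
    'rV[R]_d :=
  \row_(i < d) 'D_(delta_mx ord0 i) f x.

Definition strongly_convex (R : realType) (d : nat) (mu : R)
    (f : 'rV[R]_d -> R) : Prop :=
  forall (x y : 'rV[R]_d) (t : R), 0 <= t -> t <= 1 ->
    f (t *: x + (1 - t) *: y) <=
      t * f x + (1 - t) * f y - mu / 2 * t * (1 - t) * enorm (x - y) ^+ 2.

Definition smooth (R : realType) (d : nat) (L : R)
    (f : 'rV[R]_d -> R) : Prop :=
  (forall x : 'rV[R]_d, differentiable f x) /\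
  (forall x y : 'rV[R]_d, enorm (grad f x - grad f y) <= L * enorm (x - y)).

(* The class F_{mu,L}; the condition 0 < mu <= L is left to its users. *)
Definition Fclass (R : realType) (d : nat) (mu L : R)
    (f : 'rV[R]_d -> R) : Prop :=
  strongly_convex mu f /\ smooth L f.

(* Implicit in x_{k+1}, which occurs on both sides of the first equation. *)
Definition xv_iteration (R : realType) (d : nat)
    (f : 'rV[R]_d -> R) (s m n p q : R) (x v : nat -> 'rV[R]_d) : Prop :=
  forall k : nat,
    x k.+1 - x k = - ((m * Num.sqrt s) *: grad f (x k))
                   - (n * Num.sqrt s) *: (x k.+1 - v k) /\
    v k.+1 - v k = - ((p * Num.sqrt s) *: grad f (x k.+1))
                   - (q * Num.sqrt s) *: (v k - x k.+1).

Definition qhm_iteration (R : realType) (d : nat)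
    (f : 'rV[R]_d -> R) (s a b : R) (x g : nat -> 'rV[R]_d) : Prop :=
  forall k : nat,
    x k.+1 - x k = - ((s * (1 - a)) *: grad f (x k)) - (s * a) *: g k.+1 /\
    g k.+1 = b *: g k + grad f (x k).

(* A two-sequence scheme S whose auxiliary sequence can be eliminated: its
   x-sequences are exactly the solutions of the two-step recursion
   x_{k+1} = Phi x_k x_{k-1} for k >= 1. *)
Definition eliminates_to (T : Type) (S : (nat -> T) -> (nat -> T) -> Prop)
    (Phi : T -> T -> T) : Prop :=
  forall x : nat -> T,
    (exists w : nat -> T, S x w) <->
    (forall k : nat, x k.+2 = Phi (x k.+1) (x k)).

(* Phi is unique for each of the schemes considered here, as x_0 and x_1 are
   unconstrained; so sharing one Phi is a genuine condition. *)
Definition same_recursion (T : Type)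
    (S1 S2 : (nat -> T) -> (nat -> T) -> Prop) : Prop :=
  exists Phi : T -> T -> T, eliminates_to S1 Phi /\ eliminates_to S2 Phi.

(* Main.v *)
Require Import Defs.
From HB Require Import structures.
From mathcomp Require Import all_boot all_order all_algebra.
From mathcomp Require Import all_classical all_reals all_analysis.
From mathcomp Require Import ring lra.

Set Implicit Arguments.
Unset Strict Implicit.
Unset Printing Implicit Defensive.

Import Order.TTheory GRing.Theory Num.Theory.
Import numFieldNormedType.Exports.

Local Open Scope ring_scope.

(** The reduction is linear algebra: with alpha = q sqrt(s), the first equation
    of the iteration expresses alpha v_k through x_k, x_{k+1} and the gradient
    at x_k, and substituting this into the second one leaves [momentum_step].
    The momentum method gives the same map; going back from a solution of the
    two-step recursion to a momentum sequence needs a value of g_0, which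
    exists because b is nonzero.

    The rate comes from the Lyapunov function
<<
      E_k = f(x_k) - f(xstar) - (s/4) |grad f(x_k)|^2
            + (rho/2) |v_k - xstar|^2,      rho = a mu / (a + alpha),
>>
    which satisfies E_{k+1} <= (1 - alpha) E_k.  The iteration is a Nesterov
    scheme: a gradient step of length (1-a)s from x_k, averaged with v_k, gives
    x_{k+1}; then v_{k+1} is a convex combination of v_k and x_{k+1} followed by
    a gradient step of length gamma = p sqrt(s).  The weight rho is the one with
    rho gamma = alpha: then the inner products of grad f(x_{k+1}) with v_k that
    come from |v_{k+1} - xstar|^2 cancel those that come from 1 - alpha times
    the convexity inequality between x_k and x_{k+1} plus alpha times the strong
    convexity inequality between x_{k+1} and xstar.  What remains is a
    quadratic form in the two consecutive gradients.  It is nonpositive because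
    the first of these inequalities is the sharp one for smooth convex functions
    ([cocoercive_smooth_convex]), which has the extra term
    |grad f(x_{k+1}) - grad f(x_k)|^2 / (2L), and 1/(2L) >= 3s/8.  The term
    -(s/4) |grad f(x_k)|^2 of E_k is there for this step: without it, the
    coefficient of |grad f(x_{k+1})|^2 in the form can be positive.  All the
    terms are sums over coordinates, so this reduces to one inequality between
    real numbers, [coord_decay].

    Finally f - f(xstar) >= |grad f|^2 / (2L) >= (3s/8) |grad f|^2, so that
    removing (s/4) |grad f|^2 keeps a third of the gap: f(x_k) - f(xstar) <= 3
    E_k.  As E_0 depends only on x_0, this yields the constant. *)

(** * The Euclidean inner product *)

Definition dot (R : realType) (d : nat) (x y : 'rV[R]_d) : R :=
  \sum_(i < d) x ord0 i * y ord0 i.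

Lemma enorm_sqr (R : realType) (d : nat) (x : 'rV[R]_d) :
  enorm x ^+ 2 = dot x x.
Proof.
rewrite /enorm sqr_sqrtr; first by apply: eq_bigr => i _; rewrite expr2.
by apply: sumr_ge0 => i _; exact: sqr_ge0.
Qed.

Lemma dot_ge0 (R : realType) (d : nat) (x : 'rV[R]_d) : 0 <= dot x x.
Proof. by apply: sumr_ge0 => i _; rewrite -expr2 sqr_ge0. Qed.

Lemma dotZr (R : realType) (d : nat) (c : R) (x y : 'rV[R]_d) :
  dot x (c *: y) = c * dot x y.
Proof.
by rewrite /dot mulr_sumr; apply: eq_bigr => i _; rewrite mxE mulrCA.
Qed.

Lemma dotZl (R : realType) (d : nat) (c : R) (x y : 'rV[R]_d) :
  dot (c *: x) y = c * dot x y.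
Proof.
by rewrite /dot mulr_sumr; apply: eq_bigr => i _; rewrite mxE mulrA.
Qed.

Lemma dotBl (R : realType) (d : nat) (x y z : 'rV[R]_d) :
  dot (x - y) z = dot x z - dot y z.
Proof.
by rewrite /dot -sumrB; apply: eq_bigr => i _; rewrite !mxE mulrBl.
Qed.

(** A form of Cauchy-Schwarz that avoids dividing by a norm: it is the
    nonnegativity of |u - c v|^2. *)
Lemma dot_le_of_enorm_le (R : realType) (d : nat) (c : R) (u v : 'rV[R]_d) :
  0 < c -> enorm u <= c * enorm v -> dot u v <= c * dot v v.
Proof.
move=> c0 uv.
have sq : dot u u <= c ^+ 2 * dot v v.
  rewrite -!enorm_sqr -exprMn ler_sqr ?nnegrE ?sqrtr_ge0 //.
  by rewrite mulr_ge0 ?sqrtr_ge0 // ltW.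
have := dot_ge0 (u - c *: v).
have -> : dot (u - c *: v) (u - c *: v)
    = dot u u - 2 * c * dot u v + c ^+ 2 * dot v v.
  rewrite /dot !mulr_sumr -!sumrB -!big_split /=.
  by apply: eq_bigr => i _; rewrite !mxE; ring.
by move=> h; rewrite -(ler_pM2l c0); nra.
Qed.

(** * Smooth and strongly convex functions *)

Lemma derive_grad (R : realType) (d : nat) (f : 'rV[R]_d -> R)
    (x v : 'rV[R]_d) :
  differentiable f x -> 'D_v f x = dot (grad f x) v.
Proof.
move=> df; rewrite deriveE // {1}[v]row_sum_delta linear_sum /=.
apply: eq_bigr => i _; rewrite linearZ /= !mxE deriveE //.
by rewrite mulrC.
Qed.

Lemma is_derive_line (R : realType) (d : nat) (f : 'rV[R]_d -> R)
    (x v : 'rV[R]_d) (t : R) :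
  differentiable f (x + t *: v) ->
  is_derive t (1 : R) (fun r : R => f (x + r *: v))
    (dot (grad f (x + t *: v)) v).
Proof.
move=> df.
have q : (fun h : R => h^-1 *: (((fun r : R => f (x + r *: v)) \o shift t)
              (h *: (1 : R)) - f (x + t *: v)))
  = (fun h : R => h^-1 *: ((f \o shift (x + t *: v)) (h *: v)
              - f (x + t *: v))).
  apply/funext => h /=; congr (_ *: (f _ - _)).
  by rewrite [h%:A]mulr1 scalerDl addrCA.
split; first by rewrite /derivable q; exact: diff_derivable.
by rewrite -derive_grad // /derive q.
Qed.

(** Along the segment from x to y, f minus the quadratic on the right has a
    nonpositive derivative, since the gradient varies by at most L times the
    distance travelled. *)
Lemma smooth_quadratic_upper_bound (R : realType) (d : nat) (L : R)
    (f : 'rV[R]_d -> R) (x y : 'rV[R]_d) :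
  0 < L -> smooth L f ->
  f y <= f x + dot (grad f x) (y - x) + L / 2 * dot (y - x) (y - x).
Proof.
move=> L0 [df lip]; set v := y - x.
pose phi := (fun r : R => f (x + r *: v))
   - (dot (grad f x) v \*: (@idfun R) + (L / 2 * dot v v) \*: (@idfun R ^+ 2)).
have dphi (t : R) : is_derive t (1 : R) phi
    (dot (grad f (x + t *: v)) v
      - (dot (grad f x) v *: 1
         + (L / 2 * dot v v) *: ((2%:R * t ^+ 1) *: 1))).
  have h := is_derive_line (df (x + t *: v)).
  rewrite /phi; exact: is_deriveB.
have cphi : {within `[0, 1], continuous phi}%classic.
  by apply: derivable_within_continuous => t _; exact: ex_derive.
have le0 (t : R) : t \in `]0, 1[ -> derive1 phi t <= 0.
  rewrite in_itv /= => /andP[t0 _].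
  rewrite derive1E (@derive_val _ _ _ _ _ _ _ (dphi t)).
  have := lip (x + t *: v) x.
  have -> : x + t *: v - x = t *: v by rewrite [x + _]addrC addrK.
  move=> lt.
  have : dot (grad f (x + t *: v) - grad f x) (t *: v)
         <= L * dot (t *: v) (t *: v) by exact: dot_le_of_enorm_le.
  rewrite !dotZr !dotZl dotBl => h.
  have {}h : dot (grad f (x + t *: v)) v - dot (grad f x) v
             <= L * (t * dot v v).
    by rewrite -(ler_pM2l t0); apply: le_trans h _; rewrite mulrCA.
  by rewrite /GRing.scale /=; lra.
have phiE t : phi t
  = f (x + t *: v) - (dot (grad f x) v * t + L / 2 * dot v v * t ^+ 2) by [].
have := ler0_derive1_nincr (fun t _ => @ex_derive _ _ _ _ _ _ _ (dphi t)) le0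
  cphi (lexx 0) ler01 (lexx 1).
rewrite !phiE scale1r scale0r addr0 /v [x + _]addrC subrK -/v.
lra.
Qed.

(** The limit t -> 0+ of the strong convexity inequality at x + t (y - x), after
    division by t. *)
Lemma strongly_convex_grad (R : realType) (d : nat) (mu : R)
    (f : 'rV[R]_d -> R) (x y : 'rV[R]_d) :
  strongly_convex mu f -> differentiable f x ->
  f x + dot (grad f x) (y - x) + mu / 2 * dot (y - x) (y - x) <= f y.
Proof.
move=> sc df; set v := y - x; set D := dot v v.
have slope : ((fun h : R => h^-1 *: ((f \o shift x) (h *: v) - f x))
    @ 0^'+ --> dot (grad f x) v)%classic.
  rewrite -derive_grad //; apply: cvg_dnbhs_at_right.
  exact: (diff_derivable (v := v) df).
have bound : ((fun h : R => f y - f x - mu / 2 * D + mu / 2 * D * h) @ 0^'+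
    --> f y - f x - mu / 2 * D + mu / 2 * D * 0)%classic.
  apply: cvg_at_right_filter.
  apply: cvgD; first exact: cvg_cst.
  by apply: cvgM; [exact: cvg_cst | exact: cvg_id].
suff : dot (grad f x) v <= f y - f x - mu / 2 * D + mu / 2 * D * 0 by lra.
apply: ler_cvg_to slope bound _.
near=> h.
have h0 : 0 < h by near: h; exact: nbhs_right_gt.
have h1 : h <= 1 by near: h; exact: nbhs_right_le.
have /= := sc y x h (ltW h0) h1.
have -> : h *: y + (1 - h) *: x = h *: v + x.
  by rewrite scalerBl scale1r scalerBr addrCA [RHS]addrC addrA.
rewrite enorm_sqr -/v -/D => H.
rewrite [h^-1 *: _]mulrC ler_pdivrMr //; lra.
Unshelve. all: by end_near.
Qed.

(** Compare the affine lower bound of f at x with its quadratic upper bound at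
    y, both taken at the point z reached from y by a gradient step of length 1/L
    for the function f - dot (grad f x), which is convex and minimal at x. *)
Lemma cocoercive_smooth_convex (R : realType) (d : nat) (mu L : R)
    (f : 'rV[R]_d -> R) (x y : 'rV[R]_d) :
  0 <= mu -> 0 < L -> Fclass mu L f ->
  f x + dot (grad f x) (y - x)
    + (2 * L)^-1 * dot (grad f x - grad f y) (grad f x - grad f y) <= f y.
Proof.
move=> mu0 L0 [sc sm]; set w := grad f x - grad f y.
pose z := y + L^-1 *: w.
have lower : f x + dot (grad f x) (z - x) <= f z.
  apply: le_trans (strongly_convex_grad z sc (sm.1 x)).
  by rewrite lerDl mulr_ge0 ?dot_ge0 // divr_ge0.
have upper := smooth_quadratic_upper_bound y z L0 sm.
suff : dot (grad f x) (z - x) - dot (grad f y) (z - y)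
    - L / 2 * dot (z - y) (z - y)
  = dot (grad f x) (y - x) + (2 * L)^-1 * dot w w by lra.
rewrite /dot !mulr_sumr -!sumrB -big_split /=.
apply: eq_bigr => i _; rewrite !mxE; field.
by rewrite gt_eqF.
Qed.

(** A gradient step of length 1/L cannot go below the minimum. *)
Lemma grad_sqr_le_gap (R : realType) (d : nat) (L : R) (f : 'rV[R]_d -> R)
    (x xstar : 'rV[R]_d) :
  0 < L -> smooth L f -> (forall y, f xstar <= f y) ->
  (2 * L)^-1 * dot (grad f x) (grad f x) <= f x - f xstar.
Proof.
move=> L0 sm fmin.
have upper := smooth_quadratic_upper_bound x (x - L^-1 *: grad f x) L0 sm.
have := le_trans (fmin _) upper.
have -> : x - L^-1 *: grad f x - x = (- L^-1) *: grad f x.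
  by rewrite [x - _]addrC addrK scaleNr.
rewrite !dotZr dotZl.
have -> : L / 2 * (- L^-1 * (- L^-1 * dot (grad f x) (grad f x)))
  = 2^-1 * L^-1 * dot (grad f x) (grad f x) by field; rewrite gt_eqF.
rewrite invfM; lra.
Qed.

(** * Decay of the Lyapunov function *)

(** The decrease of the Lyapunov function in one coordinate, with
    y = x_{k+1} - xstar, w = v_k - x_{k+1} and g, g' the gradients at x_k and
    x_{k+1}.  The relation rho gamma = alpha removes the products of g' with y
    and w; the squares of y and w keep nonpositive coefficients because
    0 <= rho <= mu.  The form in g and g' left over is handled by completing the
    square in g. *)
Lemma coord_decay (R : realType) (mu a s alpha rho gamma y w g g' : R) :
  0 < a -> a <= 1 / 4 -> 0 < s -> 0 < alpha -> alpha <= 1 / 2 ->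
  0 <= rho -> rho <= mu ->
  rho * gamma = alpha -> alpha * gamma = s * (a + alpha) ->
  (1 - alpha) * (g' * (alpha * w - (1 - a) * s * g)) + alpha * (g' * y)
  - alpha * (mu / 2 * (y * y))
  - (1 - alpha) * (3 * s / 8 * ((g' - g) * (g' - g)))
  - s / 4 * (g' * g') + (1 - alpha) * (s / 4 * (g * g))
  + rho / 2 * ((y + (1 - alpha) * w - gamma * g') *
               (y + (1 - alpha) * w - gamma * g'))
  - (1 - alpha) * (rho / 2 * ((w + y) * (w + y))) <= 0.
Proof.
move=> a0 a1 s0 al0 al1 rho0 rhomu rg ag.
set Q := (X in X <= 0).
have -> : Q = - (alpha * (mu - rho) / 2 * y ^+ 2)
   - rho * alpha * (1 - alpha) / 2 * w ^+ 2
   - s * ((1 - alpha) / 8 * g ^+ 2 + (1 - alpha) * (1 / 4 - a) * (g * g')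
      + (5 / 8 - a / 2 - 7 * alpha / 8) * g' ^+ 2).
  have rgg : rho * gamma * gamma = s * (a + alpha) by rewrite rg.
  transitivity (Q - (alpha - rho * gamma) * (g' * (y + (1 - alpha) * w))
     - (rho * gamma * gamma - s * (a + alpha)) / 2 * g' ^+ 2).
    by rewrite rgg rg !subrr !mul0r !subr0.
  by rewrite /Q; field.
have y2 : 0 <= alpha * (mu - rho) / 2 * y ^+ 2.
  by rewrite mulr_ge0 ?sqr_ge0 // divr_ge0 // mulr_ge0 ?subr_ge0 // ltW.
have w2 : 0 <= rho * alpha * (1 - alpha) / 2 * w ^+ 2.
  by rewrite mulr_ge0 ?sqr_ge0 // divr_ge0 // !mulr_ge0 //; lra.
suff : 0 <= s * ((1 - alpha) / 8 * g ^+ 2 + (1 - alpha) * (1 / 4 - a) * (g * g')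
      + (5 / 8 - a / 2 - 7 * alpha / 8) * g' ^+ 2) by lra.
apply: mulr_ge0; first exact: ltW.
have -> : (1 - alpha) / 8 * g ^+ 2 + (1 - alpha) * (1 / 4 - a) * (g * g')
      + (5 / 8 - a / 2 - 7 * alpha / 8) * g' ^+ 2
  = (1 - alpha) / 8 * (g + 4 * (1 / 4 - a) * g') ^+ 2
    + (5 / 8 - a / 2 - 7 * alpha / 8 - 2 * (1 - alpha) * (1 / 4 - a) ^+ 2)
      * g' ^+ 2 by field.
apply: addr_ge0; first by rewrite mulr_ge0 ?sqr_ge0 //; lra.
rewrite mulr_ge0 ?sqr_ge0 //.
(* As a + (1/4 - a) = 1/4, these two bounds leave a margin of 1/16 even at
   alpha = 1/2. *)
have t2 : (1 / 4 - a) ^+ 2 <= (1 / 4 - a) / 4 by nra.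
have : (1 - alpha) * (1 / 4 - a) ^+ 2 <= (1 / 4 - a) ^+ 2.
  by rewrite ler_piMl ?sqr_ge0 //; lra.
lra.
Qed.

(** Here f0, f1 and fs stand for the values of f at x, x' and xstar, and the two
    last hypotheses are the convexity inequalities at x'.  Weighting them by
    1 - alpha and alpha makes the function values match the claim, and only
    inner products remain. *)
Lemma lyapunov_step (R : realType) (d : nat)
    (mu a s alpha rho gamma f0 f1 fs : R)
    (x x' g g' v v' xstar : 'rV[R]_d) :
  0 < a -> a <= 1 / 4 -> 0 < s -> 0 < alpha -> alpha <= 1 / 2 ->
  0 <= rho -> rho <= mu ->
  rho * gamma = alpha -> alpha * gamma = s * (a + alpha) ->
  x' - x = alpha *: (v - x') - ((1 - a) * s) *: g ->
  v' = v - alpha *: (v - x') - gamma *: g' ->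
  f1 + dot g' (x - x') + 3 * s / 8 * dot (g' - g) (g' - g) <= f0 ->
  f1 + dot g' (xstar - x') + mu / 2 * dot (xstar - x') (xstar - x') <= fs ->
  f1 - fs - s / 4 * dot g' g' + rho / 2 * dot (v' - xstar) (v' - xstar)
  <= (1 - alpha) * (f0 - fs - s / 4 * dot g g
                    + rho / 2 * dot (v - xstar) (v - xstar)).
Proof.
move=> a0 a1 s0 al0 al1 rho0 rhomu rg ag ex ev I2 I1.
have {}I2 := ler_wpM2l (_ : 0 <= 1 - alpha) I2.
have {}I1 := ler_wpM2l (ltW al0) I1.
have {}I2 := I2 ltac:(lra).
suff : (1 - alpha) * - dot g' (x - x') + alpha * - dot g' (xstar - x')
  - alpha * (mu / 2 * dot (xstar - x') (xstar - x'))
  - (1 - alpha) * (3 * s / 8 * dot (g' - g) (g' - g))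
  - s / 4 * dot g' g' + (1 - alpha) * (s / 4 * dot g g)
  + rho / 2 * dot (v' - xstar) (v' - xstar)
  - (1 - alpha) * (rho / 2 * dot (v - xstar) (v - xstar)) <= 0 by lra.
rewrite /dot -!sumrN !mulr_sumr -?sumrN -!big_split /=.
apply: sumr_le0 => i _.
have := coord_decay (x' ord0 i - xstar ord0 i) (v ord0 i - x' ord0 i)
  (g ord0 i) (g' ord0 i) a0 a1 s0 al0 al1 rho0 rhomu rg ag.
rewrite ev !mxE.
have -> : x ord0 i = x' ord0 i - (alpha * (v ord0 i - x' ord0 i)
    - (1 - a) * s * g ord0 i).
  by move/matrixP: ex => /(_ ord0 i); rewrite !mxE => <-; rewrite subKr.
by apply: le_trans; rewrite le_eqVlt; apply/orP; left; apply/eqP; ring.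
Qed.

(** * Elimination of the auxiliary sequence *)

Definition momentum_step (R : realType) (d : nat) (f : 'rV[R]_d -> R)
    (s a b : R) (x' x : 'rV[R]_d) : 'rV[R]_d :=
  x' + b *: (x' - x) + (b * (1 - a) * s) *: grad f x - s *: grad f x'.

Lemma xv_iteration_eliminates (R : realType) (d : nat) (f : 'rV[R]_d -> R)
    (a s m n p q b alpha : R) :
  0 < alpha -> m * Num.sqrt s = (1 - a) * s -> n * Num.sqrt s = alpha ->
  q * Num.sqrt s = alpha -> alpha * (p * Num.sqrt s) = s * (a + alpha) ->
  b = (1 - alpha) / (1 + alpha) ->
  eliminates_to (xv_iteration f s m n p q) (momentum_step f s a b).
Proof.
move=> al0 em en eq ep eb x; rewrite /xv_iteration /momentum_step em en eq.
(* The gradient is generalized so that mxE does not unfold it. *)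
move: (grad f) => gf.
have al1 : 1 + alpha != 0 by rewrite gt_eqF // addr_gt0.
have al : alpha != 0 by rewrite gt_eqF.
have ep' : p * Num.sqrt s = alpha^-1 * (s * (a + alpha)) by rewrite -ep mulKf.
split=> [[v V] k|rec].
  have [e1 e2] := V k; have [e3 _] := V k.+1.
  apply/matrixP => i j.
  move/matrixP: e1 => /(_ i j); move/matrixP: e2 => /(_ i j).
  move/matrixP: e3 => /(_ i j); rewrite !mxE ep' => e3 e2 e1.
  have vk : v k i j = alpha^-1 * ((1 + alpha) * x k.+1 i j - x k i j
                                  + (1 - a) * s * gf (x k) i j).
    apply: (mulfI al); rewrite mulVKf //; lra.
  have vk1 : v k.+1 i j = v k i j + (v k.+1 i j - v k i j) by ring.
  apply: (mulfI al1).
  have -> : (1 + alpha) * x k.+2 i j = x k.+1 i j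
      - (1 - a) * s * gf (x k.+1) i j + alpha * v k.+1 i j by lra.
  rewrite vk1 e2 vk eb; field.
  by rewrite al al1.
pose v k := alpha^-1 *: ((1 + alpha) *: x k.+1 - x k
                         + ((1 - a) * s) *: gf (x k)).
exists v => k; rewrite ep'.
by split; apply/matrixP => i j; rewrite /v ?rec ?eb !mxE; field;
  rewrite ?al ?al1.
Qed.

Lemma qhm_iteration_eliminates (R : realType) (d : nat) (f : 'rV[R]_d -> R)
    (a s b : R) :
  0 < a -> 0 < s -> 0 < b ->
  eliminates_to (qhm_iteration f s a b) (momentum_step f s a b).
Proof.
move=> a0 s0 b0 x; rewrite /qhm_iteration /momentum_step.
move: (grad f) => gf; have sa0 : s * a != 0 by rewrite mulf_neq0 ?gt_eqF.
split=> [[g G] k|rec].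
  have [e1 _] := G k; have [e2 e3] := G k.+1.
  move/matrixP: e1 => e1; move/matrixP: e2 => e2; move/matrixP: e3 => e3.
  apply/matrixP => i j.
  move: (e1 i j) (e2 i j) (e3 i j); rewrite !mxE => {}e1 {}e2 {}e3.
  have -> : x k.+2 i j = x k.+1 i j + (x k.+2 i j - x k.+1 i j) by ring.
  rewrite e1 e2 e3; ring.
(* The first equation determines g_{k+1}; the second one at k = 0 then
   determines g_0, as b is nonzero. *)
pose G k := (s * a)^-1 *: (- (x k.+1 - x k) - (s * (1 - a)) *: gf (x k)).
exists (fun k => if k is k'.+1 then G k' else b^-1 *: (G 0%N - gf (x 0%N))).
move=> k; split.
  by apply/matrixP => i j; rewrite /G !mxE; field; rewrite !gt_eqF.
case: k => [|k].
  by rewrite scalerA divff ?gt_eqF // scale1r subrK.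
rewrite /G rec; apply/matrixP => i j; rewrite !mxE; field.
by rewrite !gt_eqF.
Qed.

(** * Convergence *)

Theorem corollary3 (R : realType) (d : nat) (mu L : R)
    (f : 'rV[R]_d -> R) (xstar : 'rV[R]_d) (a s m n q p b : R) :
  0 < mu -> mu <= L ->
  Fclass mu L f ->
  (forall y : 'rV[R]_d, f xstar <= f y) ->
  0 < a -> a <= 1 / 4 ->
  0 < s ->
  m = (1 - a) * Num.sqrt s ->
  n = Num.sqrt (a * mu) ->
  q = Num.sqrt (a * mu) ->
  p = a / q + Num.sqrt s ->
  q * Num.sqrt s <= 1 / 2 ->
  s <= 4 / (3 * L) ->
  b = (1 - q * Num.sqrt s) / (1 + q * Num.sqrt s) ->
  same_recursion (xv_iteration f s m n p q) (qhm_iteration f s a b) /\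
  (forall x0 : 'rV[R]_d, exists C : R, 0 < C /\
     forall x v : nat -> 'rV[R]_d,
       x 0%N = x0 ->
       v 0%N = x0 - (m / n) *: grad f x0 ->
       xv_iteration f s m n p q x v ->
       forall k : nat,
         f (x k) - f xstar <= C * (1 - Num.sqrt (a * mu * s)) ^+ k).
Proof.
move=> mu0 muL Ff fmin a0 a4 s0 em en eq ep al2 sL eb.
have L0 : 0 < L by exact: lt_le_trans mu0 muL.
have nq : n = q by rewrite en eq.
have q0 : 0 < q by rewrite eq sqrtr_gt0 mulr_gt0.
have r0 : 0 < Num.sqrt s by rewrite sqrtr_gt0.
have rr : Num.sqrt s * Num.sqrt s = s by rewrite -expr2 sqr_sqrtr // ltW.
have qq : q * q = a * mu by rewrite -expr2 eq sqr_sqrtr // ltW // mulr_gt0.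
have -> : Num.sqrt (a * mu * s) = q * Num.sqrt s.
  by rewrite sqrtrM ?eq // ltW // mulr_gt0.
rewrite nq; clear n en nq eq; set alpha := q * Num.sqrt s in al2 eb *.
have al0 : 0 < alpha by rewrite mulr_gt0.
have alsq : alpha ^+ 2 = a * mu * s.
  by rewrite expr2 /alpha mulrACA qq rr.
have ms : m * Num.sqrt s = (1 - a) * s by rewrite em -mulrA rr.
have ps : alpha * (p * Num.sqrt s) = s * (a + alpha).
  rewrite ep mulrDl rr /alpha.
  have -> : q * Num.sqrt s * (a / q * Num.sqrt s + s)
    = a * (Num.sqrt s * Num.sqrt s) + s * (q * Num.sqrt s).
    by field; rewrite gt_eqF.
  by rewrite rr; ring.
split.
  exists (momentum_step f s a b); split.
    exact: xv_iteration_eliminates al0 ms _ _ ps eb.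
  apply: qhm_iteration_eliminates => //.
  by rewrite eb divr_gt0 //; lra.
pose rho := a * mu / (a + alpha); pose gamma := p * Num.sqrt s.
have aal : 0 < a + alpha by exact: addr_gt0.
have rho0 : 0 <= rho by rewrite divr_ge0 ?mulr_ge0 // ltW.
have rhomu : rho <= mu.
  by rewrite ler_pdivrMr // mulrC ler_pM2l //; lra.
have rg : rho * gamma = alpha.
  apply: (mulfI (lt0r_neq0 al0)).
  rewrite mulrCA ps -expr2 alsq /rho.
  by field; rewrite gt_eqF.
(* The bound s <= 4 / (3 L) is exactly this comparison. *)
have sL8 : 3 * s / 8 <= (2 * L)^-1.
  move: sL; rewrite ler_pdivlMr ?mulr_gt0 // => sL.
  rewrite -[leRHS]mul1r ler_pdivlMr ?mulr_gt0 //; lra.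
pose E x v := f x - f xstar - s / 4 * dot (grad f x) (grad f x)
              + rho / 2 * dot (v - xstar) (v - xstar).
have gapE x v : f x - f xstar <= 3 * E x v.
  have h := grad_sqr_le_gap x L0 Ff.2 fmin.
  have h1 := ler_wpM2r (dot_ge0 (grad f x)) sL8.
  have h2 : 0 <= rho / 2 * dot (v - xstar) (v - xstar).
    by rewrite mulr_ge0 ?dot_ge0 // divr_ge0.
  rewrite /E; lra.
move=> x0; pose E0 := E x0 (x0 - (m / q) *: grad f x0).
have E00 : 0 <= E0.
  have := gapE x0 (x0 - (m / q) *: grad f x0); have := fmin x0.
  by rewrite /E0; lra.
exists (3 * E0 + 1); split; first lra.
move=> x v ex ev it k.
have decay : E (x k) (v k) <= E0 * (1 - alpha) ^+ k.
  elim: k => [|k IH]; first by rewrite expr0 mulr1 ex ev.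
  have [e1 e2] := it k.
  apply: (@le_trans _ _ ((1 - alpha) * E (x k) (v k))); last first.
    by rewrite exprS mulrCA ler_pM2l //; lra.
  apply: (lyapunov_step (mu := mu) (a := a) (gamma := gamma)
            (x := x k) (x' := x k.+1)) => //.
  - by rewrite e1 ms -/alpha addrC -scalerN opprB.
  - by rewrite -[LHS](subrK (v k)) e2 -/gamma -/alpha addrC addrA addrAC.
  - have := cocoercive_smooth_convex (x k.+1) (x k) (ltW mu0) L0 Ff.
    by apply: le_trans; rewrite lerD2l ler_wpM2r ?dot_ge0.
  - exact: strongly_convex_grad Ff.1 (Ff.2.1 _).
apply: le_trans (gapE _ (v k)) _.
have : 0 <= (1 - alpha) ^+ k by apply: exprn_ge0; lra.
lra.
Qed.
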